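(* Let $G$ be a connected weighted plane graph symmetric with respect to reflection across a horizontal line $\ell$, and let $v$ be a vertex of $G$ lying on $\ell$ and on the unbounded face. Let $v_1,\dots,v_n$ be the vertices of $G$ other than $v$ that lie on $\ell$ and are not incident to any edge contained in $\ell$. Choose a spanning tree $T$ uniformly at random from the set of spanning trees of $G$ rooted at $v$, and let $Y_i$ be the random variable equal to $1$ if the unique outgoing edge of $v_i$ in $T$ lies above $\ell$, and $0$ otherwise. Then $Y_1,\dots,Y_n$ are independent and identically distributed Bernoulli random variables with parameter $1/2$.
   Context: Graphs have no loops or multiple edges. A spanning tree rooted at $v$ has each edge oriented toward $v$, so each vertex other than $v$ has exactly one outgoing edge. *)

(* Defs.v *)
From HB Require Import structures.
From mathcomp Require Import all_boot all_order all_algebra.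
From mathcomp Require Import all_classical all_reals all_analysis.

Set Implicit Arguments.
Unset Strict Implicit.
Unset Printing Implicit Defensive.

Import Order.TTheory GRing.Theory Num.Theory.
Import numFieldNormedType.Exports.

Local Open Scope classical_set_scope.
Local Open Scope ring_scope.

Definition is_arc (R : realType) (p q : R * R) (A : set (R * R)) : Prop :=
  exists g : R -> R * R,
    [/\ {within `[0, 1], continuous g},
        {in `[0, 1] &, injective g},
        g 0 = p, g 1 = q & A = g @` `[0, 1]].

(* Finite simple graphs drawn in the plane: [edge_arc] excludes loops and     *)
(* [ends_inj] excludes multiple edges.                                        *)
Record plane_graph (R : realType) := PlaneGraph {
  vertex : finType ;
  edge : finType ;
  location : vertex -> R * R ;
  ends : edge -> {set vertex} ;
  curve : edge -> set (R * R) ;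
  location_inj : injective location ;
  ends_inj : injective ends ;
  edge_arc : forall e, exists x y,
    [/\ x != y, ends e = [set x; y]%SET & is_arc (location x) (location y) (curve e)] ;
  curve_vertex : forall e x, curve e (location x) -> x \in ends e ;
  curve_disjoint : forall e f p, e != f -> curve e p -> curve f p ->
    exists2 x, x \in ends e :&: ends f & p = location x }.

Section Graph.
Context {R : realType} {G : plane_graph R}.
Implicit Types (t : {set edge G}) (u x y : vertex G) (e f : edge G).

Definition adj t : rel (vertex G) :=
  fun x y => [exists e in t, ends e == [set x; y]%SET].

Definition spans_connected t : Prop := forall x y, connect (adj t) x y.

(* The graph is simple, so a cycle has at least three vertices; shorter       *)
(* [ucycle]s of a symmetric relation are not cycles of the graph.             *)
Definition acyclic t : Prop :=
  forall s : seq (vertex G), (2 < size s)%N -> ~ ucycle (adj t) s.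

Definition is_spanning_tree t : Prop := spans_connected t /\ acyclic t.

(* [e] is the first edge of a simple path in [t] from [u] to the root [v]:    *)
(* orienting the edges of a spanning tree toward [v] makes [e] outgoing       *)
(* from [u].                                                                  *)
Definition outgoing (v : vertex G) t u e : Prop :=
  exists (w : vertex G) (s : seq (vertex G)),
    [/\ e \in t, ends e = [set u; w]%SET, path (adj t) w s, last w s = v
      & uniq [:: u, w & s]].

Definition drawing : set (R * R) :=
  range (@location R G) `|` \bigcup_(e in [set: edge G]) curve e.

Definition on_unbounded_face u : Prop :=
  exists p : R * R,
    let face := connected_component (~` drawing) p in
    [/\ ~ drawing p, ~ bounded_set face & closure face (location u)].

Definition line (c : R) : set (R * R) := [set p | p.2 = c].

Definition reflect_line (c : R) (p : R * R) : R * R := (p.1, c *+ 2 - p.2).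

Definition symmetric_graph (w : edge G -> R) (c : R) : Prop :=
  (forall x, exists y, location y = reflect_line c (location x)) /\
  (forall e, exists2 f, curve f = reflect_line c @` curve e & w f = w e).

(* The ends of [e] are exempted: they may lie on the line.                    *)
Definition edge_above (c : R) e : Prop :=
  forall p, curve e p -> (forall x, x \in ends e -> p <> location x) -> c < p.2.

Definition isolated_on_line (c : R) (v u : vertex G) : Prop :=
  [/\ u != v, line c (location u)
    & forall e, u \in ends e -> ~ (curve e `<=` line c)].

End Graph.

(* The orientation toward a root is determined by the root, hence spanning    *)
(* trees rooted at a given vertex are identified with spanning trees.         *)
Record spanning_tree (R : realType) (G : plane_graph R) := SpanningTree {
  tree_edges :> {set edge G} ;
  _ : `[< is_spanning_tree tree_edges >] }.

HB.instance Definition _ (R : realType) (G : plane_graph R) :=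
  [isSub for @tree_edges R G].
HB.instance Definition _ (R : realType) (G : plane_graph R) :=
  [Finite of spanning_tree G by <:].

Definition tree_weight (R : realType) (G : plane_graph R) (w : edge G -> R)
  (t : spanning_tree G) : R := \prod_(e in tree_edges t) w e.

Section Random.
Context d (Omega : measurableType d) (R : realType) (P : probability Omega R).

Definition has_law (T : finType) (X : Omega -> T) (mu : T -> R) : Prop :=
  forall t, measurable (X @^-1` [set t]) /\ P (X @^-1` [set t]) = (mu t)%:E.

Definition mutually_independent d' (T : measurableType d') (I : finType)
  (X : I -> Omega -> T) : Prop :=
  forall (J : {set I}) (A : I -> set T), (forall i, i \in J -> measurable (A i)) ->
    P (\bigcap_(i in [set i | i \in J]) (X i @^-1` A i)) =
    (\prod_(i in J) P (X i @^-1` A i))%E.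

End Random.

Definition uniform_tree_law (R : realType) (G : plane_graph R)
  (t : spanning_tree G) : R := #|{: spanning_tree G}|%:R^-1.

Definition weighted_tree_law (R : realType) (G : plane_graph R)
  (w : edge G -> R) (t : spanning_tree G) : R :=
  tree_weight w t / \sum_(t' : spanning_tree G) tree_weight w t'.

(* Main.v *)
(* Reflection gives an involution sigma of the vertices and one of the edges. *)
(* An edge at v_i that crosses or touches the line elsewhere would be its own *)
(* mirror image, hence contained in the line; so the edges at v_i are paired  *)
(* off, one above and one below, with equal weights. By the matrix-tree       *)
(* theorem, the weight of the trees with prescribed values of Y_1, ..., Y_n   *)
(* is the determinant of the Laplacian L in which row i keeps only the edges  *)
(* of the prescribed side. Such a row is half the row of L plus half a row    *)
(* that is odd under sigma. As L commutes with sigma, the odd part is a       *)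
(* combination of differences of mirror rows of L and does not contribute to  *)
(* the determinant, which is therefore det L / 2^n whatever the prescription. *)
(* The uniform law is the case of constant weights.                           *)
Require Import Defs.
From HB Require Import structures.
From mathcomp Require Import all_boot all_order all_algebra.
From mathcomp Require Import perm lra.
From mathcomp Require Import all_classical all_reals all_analysis.
Import Order.TTheory GRing.Theory Num.Theory.
Import numFieldNormedType.Exports.

Set Implicit Arguments.
Unset Strict Implicit.
Unset Printing Implicit Defensive.

Local Open Scope classical_set_scope.
Local Open Scope ring_scope.

(** * Determinants and the matrix-tree expansion *)

(** All [2 ^ n] patterns of sides turn out to carry the same total weight of trees, and a random bit
    vector with constant law has independent fair coordinates ([uniform_bits]).

    Spanning trees correspond to maps sending each vertex to its parent. This yields a matrix-tree
    theorem in which the weight of an edge may depend on its tail ([sum_spanning_trees]), so a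
    pattern is imposed by cancelling, in the rows of the [vs i], the edges on the wrong side
    ([prod_pattern_weight]). Reflection exchanges the two sides at each [vs i] ([edge_above_mirror],
    resting on the topological fact [arc_involution_id]), hence such a row and its mirror image add
    up to the full row of the Laplacian ([laplacian_half]). As the Laplacian commutes with the
    reflection, each of these rows counts in the determinant as half of the full row
    ([det_half_rows]), whence the factor [2^-1 ^+ n] in [sum_pattern_weight]. *)

Lemma det_perm_id (K : comNzRingType) (n : nat) (A : 'M[K]_n) :
  (forall s : 'S_n, s != 1%g -> exists i, A i (s i) = 0) ->
  \det A = \prod_i A i i.
Proof.
move=> As; rewrite /determinant (bigD1 (1%g : 'S_n)) //= odd_perm1 expr0 mul1r.
rewrite [X in _ + X]big1 ?addr0 => [|s /As[i Ai0]].
  by apply: eq_bigr => i _; rewrite perm1.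
by rewrite (bigD1 i) //= Ai0 mul0r mulr0.
Qed.

Definition finmx (K : Type) (V : finType) (F : V -> V -> K) : 'M[K]_#|V| :=
  \matrix_(i, j) F (enum_val i) (enum_val j).

Lemma eq_finmx (K : Type) (V : finType) (F F' : V -> V -> K) :
  (forall u x, F u x = F' u x) -> finmx F = finmx F'.
Proof. by move=> FF'; apply/matrixP => i j; rewrite !mxE FF'. Qed.

Lemma big_rank (K : Type) (idx : K) (op : Monoid.com_law idx) (V : finType)
    (F : V -> K) : \big[op/idx]_(i < #|V|) F (enum_val i) = \big[op/idx]_u F u.
Proof.
by rewrite [RHS](reindex _ (onW_bij _ (@enum_val_bij V))).
Qed.

(** Multilinearity in the rows: a term of the expansion picks one summand [f u] in each row [u]. *)
Lemma det_row_expansion (K : comNzRingType) (V : finType)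
    (a : V -> V -> K) (m : V -> V -> V -> K) :
  \det (finmx (fun u x => \sum_z a u z * m u z x)) =
  \sum_(f : {ffun V -> V})
     (\prod_u a u (f u)) * \det (finmx (fun u x => m u (f u) x)).
Proof.
under [RHS]eq_bigr do rewrite mulr_sumr.
rewrite exchange_big; apply: eq_bigr => /= s _.
under eq_bigr do rewrite mxE.
rewrite bigA_distr_bigA /= big_distrr /=.
have bij_h : {on [pred _ : {ffun 'I_#|V| -> V} | true],
    bijective (fun f : {ffun V -> V} => [ffun i => f (enum_val i)])}.
  apply: onW_bij; exists (fun g : {ffun 'I_#|V| -> V} =>
    [ffun u => g (enum_rank u)]) => g.
    by apply/ffunP => u; rewrite !ffunE enum_rankK.
  by apply/ffunP => i; rewrite !ffunE enum_valK.
rewrite (reindex _ bij_h) /=; apply: eq_bigr => f _.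
rewrite big_split /= mulrCA -(big_rank _ (fun u => a u (f u))); congr (_ * (_ * _)).
  by apply: eq_bigr => i _; rewrite ffunE.
by apply: eq_bigr => i _; rewrite !(mxE, ffunE).
Qed.

(** Identity minus the transition matrix of [f], with the step out of [v] removed. *)
Definition parent_mx (K : fieldType) (V : finType) (v : V) (f : V -> V) :=
  finmx (fun u x => (x == u)%:R - (if u == v then 0 else (x == f u)%:R) : K).

(** If every vertex leads to [v], a permutation with a nonzero Leibniz term follows [f] wherever it
    moves a point; a moved point would have all its iterates under [f] moved, including [v], which
    must stay fixed. So only the identity contributes. Otherwise the indicator of the vertices not
    leading to [v] lies in the kernel, being constant along [f]. *)
Lemma det_parent_mx (K : fieldType) (V : finType) (v : V) (f : V -> V) :
  f v = v -> \det (parent_mx K v f) = [forall u, fconnect f u v]%:R.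
Proof.
move=> fv; case: (boolP [forall u, _]) => [/forallP fP | /forallPn[u0 u0P]].
  rewrite det_perm_id => [|s s1].
    rewrite big1 // => i _; rewrite !mxE eqxx; case: eqP => [_|/eqP iv].
      by rewrite subr0.
    case: eqP => [fi|]; rewrite ?subr0 //.
    have /iter_findex := fP (enum_val i).
    by rewrite iter_fix // => /eqP; rewrite (negPf iv).
  pose t u := enum_val (s (enum_rank u)).
  have t_inj : injective t.
    by move=> x y /enum_val_inj /perm_inj /enum_rank_inj.
  have [u tu] : exists u, t u != u.
    have [/existsP[u]|/existsPn tid] := boolP [exists u, t u != u].
      by exists u.
    case/eqP: s1; apply/permP => i; rewrite perm1; apply: enum_val_inj.
    by move: (tid (enum_val i)); rewrite negbK /t enum_valK => /eqP.
  case: (pickP (fun i => parent_mx K v f i (s i) == 0)) => [i /eqP|nz].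
    by exists i.
  have tP x : t x = x \/ x != v /\ t x = f x.
    have := nz (enum_rank x); rewrite !mxE enum_rankK -/(t x).
    case: (t x =P x) => [-> _|_]; first by left.
    case: (x == v); rewrite ?subr0 ?eqxx //.
    by case: (t x =P f x) => [-> _|]; [right|rewrite subr0 eqxx].
  have tk k : t (iter k f u) != iter k f u.
    elim: k => //= k IHk; case: (tP (iter k f u)) => [tE|[_ tE]].
      by rewrite tE eqxx in IHk.
    by rewrite -tE; apply: contra IHk => /eqP/t_inj ->.
  have := tk (findex f u v); rewrite iter_findex ?fP //.
  by case: (tP v) => [->|[]]; rewrite eqxx.
rewrite -det_tr; apply/eqP/det0P.
exists (\row_i (~~ fconnect f (enum_val i) v)%:R).
  apply/eqP => /rowP /(_ (enum_rank u0)) /eqP.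
  by rewrite !mxE enum_rankK u0P oner_eq0.
apply/rowP => j; rewrite !mxE.
under eq_bigr do rewrite !mxE.
rewrite (big_rank _ (fun x => (~~ fconnect f x v)%:R * (((x == enum_val j)%:R -
   (if enum_val j == v then 0 else (x == f (enum_val j))%:R)) : K))).
move: (enum_val j) => u.
have sum1 y : \sum_x (~~ fconnect f x v)%:R * (x == y)%:R =
    (~~ fconnect f y v)%:R :> K.
  rewrite (bigD1 y) //= eqxx mulr1 big1 ?addr0 // => x /negPf ->.
  by rewrite mulr0.
case: eqP => [->|/eqP uv].
  under eq_bigr do rewrite subr0.
  by rewrite sum1 connect0.
under eq_bigr do rewrite mulrBr.
rewrite sumrB !sum1 fconnect_eqVf (negPf uv) /=.
by rewrite subrr.
Qed.

(** Row [v] is replaced by a basis vector instead of being deleted with column [v]; the determinant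
    is that of the reduced Laplacian. The weight [a u z] belongs to the step from [u] to [z] and may
    differ from [a z u]. *)
Definition laplacian (K : fieldType) (V : finType) (v : V) (a : V -> V -> K) :
  V -> V -> K :=
  fun u x => if u == v then (x == v)%:R
             else \sum_z a u z * ((x == u)%:R - (x == z)%:R).

(* Choosing one summand in each row turns the Laplacian into the matrices of  *)
(* the maps [f], of which only those leading every vertex to [v] survive.     *)
Lemma det_laplacian (K : fieldType) (V : finType) (v : V) (a : V -> V -> K) :
  \det (finmx (laplacian v a)) =
  \sum_(f : {ffun V -> V} | (f v == v) && [forall u, fconnect f u v])
     \prod_(u | u != v) a u (f u).
Proof.
(* Row [v] is also written as a sum over [z], concentrated at [z = v], which forces [f v = v]. *)
pose b u z := if u == v then (z == v)%:R else a u z.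
pose m u z x : K := (x == u)%:R - (if u == v then 0 else (x == z)%:R).
transitivity (\det (finmx (fun u x => \sum_z b u z * m u z x))).
  congr (\det _); apply: eq_finmx => u x; rewrite /laplacian /b /m.
  case: eqP => [->|//]; under eq_bigr do rewrite subr0.
  by rewrite (bigD1 v) //= eqxx mul1r big1 ?addr0 // => z /negPf ->; rewrite mul0r.
rewrite det_row_expansion [RHS]big_mkcond; apply: eq_bigr => f _.
rewrite (bigD1 v) //= /b eqxx; case: eqP => [fv|_]; last by rewrite !mul0r.
rewrite mul1r [X in _ * X]det_parent_mx //=.
case: [forall u, _]; rewrite ?mulr1 ?mulr0 //.
by apply: eq_bigr => u /negPf ->.
Qed.

(* The rows [M_i] with [i] in [S] are halves of [L_i] plus antisymmetric      *)
(* vectors. Since [L] commutes with [s], the rows of [M L^-1] indexed by [S]  *)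
(* are halves of basis vectors plus antisymmetric vectors; the latter vanish  *)
(* on [S], which leaves only the identity in the Leibniz formula.             *)
Lemma det_half_rows (K : fieldType) (n : nat) (L M : 'M[K]_n) (s : 'I_n -> 'I_n)
    (S : {set 'I_n}) :
  2 != 0 :> K -> L \in unitmx -> involutive s ->
  (forall i j, L (s i) (s j) = L i j) -> {in S, forall i, s i = i} ->
  (forall i, i \notin S -> row i M = row i L) ->
  (forall i j, i \in S -> M i j + M i (s j) = L i j) ->
  \det M = 2^-1 ^+ #|S| * \det L.
Proof.
move=> two Lu sK Ls sS MnS ML.
(* Twice the odd part of row [i] of [M]; for [i] in [S], row [i] of [L] is twice the even part. *)
pose D i j := M i j - M i (s j).
have Ds i j : D i (s j) = - D i j by rewrite /D sK opprB.
have MS i j : i \in S -> M i j = 2^-1 * (L i j + D i j).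
  move=> iS; rewrite -ML // addrACA subrr addr0 -mulr2n -(mulr_natl (M i j)).
  by rewrite mulKf.
pose B := (\matrix_(i, j) D i j) *m invmx L.
have Bs i j : B i (s j) = - B i j.
  suff: \matrix_(i, j) B i (s j) = - B by move/matrixP/(_ i j); rewrite !mxE.
  apply: (can_inj (mulmxK Lu)); rewrite mulNmx mulmxKV //.
  apply/matrixP => k l; rewrite [LHS]mxE [RHS]mxE [in RHS]mxE -Ds.
  transitivity ((B *m L) k (s l)); last by rewrite mulmxKV // mxE.
  rewrite [RHS]mxE (reindex_inj (can_inj sK)) /=; apply: eq_bigr => z _.
  by rewrite mxE -[in LHS](sK l) Ls sK.
have BS i j : j \in S -> B i j = 0.
  move=> jS; have := Bs i j; rewrite sS // => /eqP.
  by rewrite -addr_eq0 -mulr2n -mulr_natl mulf_eq0 (negPf two) => /eqP.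
pose C : 'M[K]_n := \matrix_(i, j)
  (if i \in S then 2^-1 * ((i == j)%:R + B i j) else (i == j)%:R).
have -> : M = C *m L.
  apply/matrixP => i j; rewrite mxE; have [iS|iS] := boolP (i \in S).
    under eq_bigr do rewrite mxE iS -mulrA mulrDl.
    rewrite -mulr_sumr big_split /= MS //; congr (_ * (_ + _)).
      rewrite (bigD1 i) //= eqxx mul1r big1 ?addr0 // => z /negPf.
      by rewrite eq_sym => ->; rewrite mul0r.
    transitivity ((B *m L) i j); last by rewrite mxE.
    by rewrite mulmxKV // mxE.
  under eq_bigr do rewrite mxE (negPf iS).
  move/rowP: (MnS _ iS) => /(_ j); rewrite !mxE => ->.
  rewrite (bigD1 i) //= eqxx mul1r big1 ?addr0 // => z /negPf.
  by rewrite eq_sym => ->; rewrite mul0r.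
rewrite det_mulmx; congr (_ * _); rewrite det_perm_id => [|t t1].
  rewrite (bigID (mem S)) /= [X in _ * X]big1 => [|i /negPf iS]; last first.
    by rewrite mxE iS eqxx.
  rewrite mulr1 -prodr_const; apply: eq_bigr => i iS.
  by rewrite mxE iS BS // eqxx addr0 mulr1.
have [i ti] : exists i, t i != i.
  have [/existsP[i]|/existsPn tid] := boolP [exists i, t i != i]; first by exists i.
  by case/eqP: t1; apply/permP => i; rewrite perm1; move/negbNE/eqP: (tid i).
have [iS|iS] := boolP (i \in S); last first.
  by exists i; rewrite mxE (negPf iS) eq_sym (negPf ti).
have [tiS|tiS] := boolP (t i \in S).
  by exists i; rewrite mxE iS BS // eq_sym (negPf ti) addr0 mulr0.
(* By injectivity [t] moves [t i] as well, and row [t i] of [C] is a basis vector. *)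
exists (t i); rewrite mxE (negPf tiS); case: eqP => // /perm_inj tt.
by rewrite -tt eqxx in ti.
Qed.

(** * Spanning trees as parent maps *)

Lemma set2_eq (T : finType) (a b x y : T) :
  a != b -> [set a; b]%SET = [set x; y]%SET ->
  (a = x /\ b = y) \/ (a = y /\ b = x).
Proof.
move=> ab /setP E; move: (E a) (E b) (E x) (E y) ab; rewrite !inE !eqxx !orbT.
move=> /esym/orP[]/eqP-> /esym/orP[]/eqP->; rewrite ?eqxx //=; first by left.
by right.
Qed.

Section Trees.
Context {R : realType} {G : plane_graph R} (v : vertex G).
Implicit Types (t : {set edge G}) (u x y : vertex G) (e : edge G)
  (f : vertex G -> vertex G).

Lemma ends_neq e x y : ends e = [set x; y]%SET -> x != y.
Proof.
move=> exy; have [a [b [ab eab _]]] := edge_arc e.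
by apply: contraTneq isT => xy; move/eqP: (cards2 a b);
   rewrite -eab exy xy finset.setUid cards1 ab.
Qed.

Lemma adj_sym t : symmetric (adj t).
Proof. by move=> x y; rewrite /adj finset.setUC. Qed.

Lemma adj_of_ends t e x y : e \in t -> ends e = [set x; y]%SET -> adj t x y.
Proof. by move=> et exy; apply/existsP; exists e; rewrite et exy eqxx. Qed.

Lemma outgoing_neq t u e : outgoing v t u e -> u != v.
Proof.
case=> w [s [_ _ _ sv /= /andP[uws _]]]; apply: contraNneq uws => ->.
by rewrite -sv mem_last.
Qed.

(* Two simple paths from [u] to [v] with distinct first steps would close up  *)
(* to a cycle through [u].                                                    *)
Lemma outgoing_inj t u e e' :
  acyclic t -> outgoing v t u e -> outgoing v t u e' -> e = e'.
Proof.
move=> tA [w [s [et ew ps sv us]]] [w' [s' [et' ew' ps' sv' us']]].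
apply: ends_inj; rewrite ew ew'; case: (w =P w') => [-> //|/eqP ww'].
(* Adjacency in [t] with [u] removed: the two paths without their first step join [w] and [w'] to
   [v] there. *)
pose r := [rel x y | [&& adj t x y, x != u & y != u]].
have rS x y : r x y = r y x by rewrite /= adj_sym [X in _ && X]andbC.
have r_path z p : uniq [:: u, z & p] -> path (adj t) z p -> connect r z (last z p).
  rewrite /= => /andP[uzp _] pp; apply/connectP; exists p => //.
  apply: (sub_in_path (P := fun x => x != u)) pp => [x y xu yu xy|].
    exact/and3P.
  by apply/allP => x xzp; apply: contraNneq uzp => <-.
have : connect r w w'.
  apply: (connect_trans (r_path _ _ us ps)); rewrite sv -sv' sym_connect_sym //.
  exact: r_path.
case/connectP => p0 /shortenP[p pp up _] w'E {p0}.
case: (tA [:: u, w & p]).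
  by case: p pp up w'E ww' => //= _ _ ->; rewrite eqxx.
have p_u : u \notin p.
  have : all (fun x => x != u) p.
    elim: p (w) pp {up w'E} => //= y p IHp x /andP[/and3P[_ _ ->]].
    exact: IHp.
  by move/allP => pu; apply/negP => /pu; rewrite eqxx.
rewrite /ucycle [uniq _]/= -/(uniq (w :: p)) up inE negb_or p_u (ends_neq ew).
rewrite /= rcons_path (adj_of_ends et ew) -w'E adj_sym (adj_of_ends et' ew').
by rewrite (sub_path _ pp) // => x y /and3P[].
Qed.

Lemma simple_path t x y : spans_connected t ->
  exists p, [/\ path (adj t) x p, last x p = y & uniq (x :: p)].
Proof. by move=> /(_ x y)/connectP[p0 /shortenP[p pp up _] ->]; exists p. Qed.

Arguments simple_path {t} x y.

Lemma outgoing_exists t u : spans_connected t -> u != v ->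
  exists e, outgoing v t u e.
Proof.
move=> tC; have [[|w s] [/= ps sv us]] := simple_path u v tC => uv.
  by rewrite sv eqxx in uv.
case/andP: ps => /existsP[e /andP[et /eqP ew]] ps.
by exists e, w, s.
Qed.

(** The default value [u] makes the root, which has no outgoing edge, a fixed point. *)
Definition parent t u : vertex G :=
  if [pick x | `[< exists2 e, outgoing v t u e & ends e = [set u; x]%SET >]]
  is Some x then x else u.

Lemma parent_root t : parent t v = v.
Proof.
rewrite /parent; case: pickP => // x /asboolP[e /outgoing_neq].
by rewrite eqxx.
Qed.

Lemma outgoing_parent t u e : is_spanning_tree t -> u != v ->
  outgoing v t u e <-> ends e = [set u; parent t u]%SET.
Proof.
move=> [tC tA] uv; have [e' oe'] := outgoing_exists tC uv.
have [e1 oe1 e1E] : exists2 e, outgoing v t u e & ends e = [set u; parent t u]%SET.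
  rewrite /parent; case: pickP => [x /asboolP //|/= no].
  have [w [s [_ ew _ _ _]]] := oe'.
  by move: (no w) => /asboolP[]; exists e'.
split=> [oe|eE]; first by rewrite (outgoing_inj tA oe oe1).
by rewrite (_ : e = e1) //; apply: ends_inj; rewrite eE.
Qed.

Lemma parentE t u e x : is_spanning_tree t -> outgoing v t u e ->
  ends e = [set u; x]%SET -> parent t u = x.
Proof.
move=> tT oe ex; have /(outgoing_parent _ tT) := outgoing_neq oe.
move=> /(_ e) [/(_ oe)]; rewrite ex => /(set2_eq (ends_neq ex)) [[]//|[<- ->]//].
Qed.

Lemma parent_connect t u : is_spanning_tree t -> fconnect (parent t) u v.
Proof.
move=> tT; have [p [pp pv up]] := simple_path u v tT.1.
elim: p u pp pv up => [u _ /= -> //|w p IHp u /= /andP[auw pp] pv up].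
have [/existsP[e /andP[et /eqP ew]]] := auw.
have /(parentE tT) /(_ ew) pu : outgoing v t u e by exists w, p.
apply: connect_trans (fconnect1 _ u) _; rewrite pu; apply: IHp => //.
by case/andP: up.
Qed.

Definition tree_of f : {set edge G} :=
  [set e | [exists u, (u != v) && (ends e == [set u; f u]%SET)]].

Lemma tree_ofP f e :
  reflect (exists2 u, u != v & ends e = [set u; f u]%SET) (e \in tree_of f).
Proof.
rewrite inE; apply: (iffP existsP) => [[u /andP[uv /eqP]]|[u uv /eqP]].
  by exists u.
by exists u; rewrite uv.
Qed.

(** Every edge [xy] of [t] is outgoing from one of its ends. On the simple path from [x] to [v],
    either [y] is absent and the edge leaves [y], or [y] comes next and the edge leaves [x]; a later
    occurrence of [y] would close a cycle. *)
Lemma tree_of_parent t : is_spanning_tree t -> tree_of (parent t) = t.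
Proof.
move=> tT; apply/setP => e; apply/tree_ofP/idP => [[u uv]|et].
  by move/(outgoing_parent _ tT uv) => [w [s []]].
have [x [y [xy exy _]]] := edge_arc e.
have [p [pp pv up]] := simple_path x v tT.1.
have eyx : ends e = [set y; x]%SET by rewrite exy finset.setUC.
suff [z oz] : exists z, outgoing v t z e.
  have zv := outgoing_neq oz; exists z => //.
  exact/(outgoing_parent _ tT zv).
have [yp|yp] := boolP (y \in p); last first.
  exists y, x, p; split => //=; rewrite inE eq_sym negb_or xy yp /=.
  exact: up.
case/splitPr: yp pp pv up => -[|z p1] p2 pp pv up.
  by exists x, y, p2; split => //; case/andP: pp.
case: (tT.2 (x :: rcons (z :: p1) y)); first by rewrite /= size_rcons.
rewrite -cat_rcons cat_path in pp; rewrite -cat_rcons -cat_cons cat_uniq in up.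
case/andP: pp => pp _; case/and3P: up => up _ _.
rewrite /ucycle up andbT -[cycle _ _]/(path _ x (rcons (rcons (z :: p1) y) x)).
rewrite rcons_path pp last_rcons /=.
exact: adj_of_ends et eyx.
Qed.

Definition is_parent_map f : Prop :=
  [/\ f v = v, forall u, fconnect f u v
    & forall u, u != v -> exists e, ends e = [set u; f u]%SET].

Lemma is_parent_map_parent t : is_spanning_tree t -> is_parent_map (parent t).
Proof.
move=> tT; split=> [|u|u uv]; [exact: parent_root|exact: parent_connect|].
have [e oe] := outgoing_exists tT.1 uv; exists e.
exact/(outgoing_parent _ tT uv).
Qed.

Section ParentMap.
Variables (f : vertex G -> vertex G) (fP : is_parent_map f).

Let depth u := findex f u v.

Lemma depth_parent u : u != v -> depth u = (depth (f u)).+1.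
Proof.
by move=> uv; rewrite /depth fconnect_findex 1?eq_sym //; case: fP.
Qed.

(** Otherwise [u] and [z] would be parents of each other, each one step deeper than the other. *)
Lemma parent_map_set2 u z : u != v -> z != v ->
  [set u; f u]%SET = [set z; f z]%SET -> u = z.
Proof.
move=> uv zv E; have [_ _ /(_ u uv)[e /ends_neq ufu]] := fP.
case: (set2_eq ufu E) => [[]//|[uE zE]].
have := depth_parent uv; rewrite zE (depth_parent zv) -uE => /eqP.
by rewrite -addn2 -[X in X == _]addn0 eqn_add2l.
Qed.

Lemma adj_tree_of u : u != v -> adj (tree_of f) u (f u).
Proof.
move=> uv; have [_ _ /(_ u uv)[e eu]] := fP; apply: (adj_of_ends _ eu).
by apply/tree_ofP; exists u.
Qed.

Lemma tree_of_connected : spans_connected (tree_of f).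
Proof.
have conn_v x : connect (adj (tree_of f)) x v.
  have [fv fC _] := fP; have := fC x; apply: connect_sub => y z /= /eqP <-.
  by have [->|yv] := eqVneq y v; [rewrite fv|exact/connect1/adj_tree_of].
move=> x y; apply: connect_trans (conn_v x) _.
by rewrite sym_connect_sym //; exact: adj_sym.
Qed.

Lemma adj_tree_of_depth u x :
  adj (tree_of f) u x -> (depth x <= depth u)%N -> x = f u.
Proof.
case/existsP => e /andP[/tree_ofP[z zv ez] /eqP eux].
have ux := ends_neq eux; rewrite eux in ez.
case: (set2_eq ux ez) => -[-> ->] //.
by rewrite [X in (X <= _)%N]depth_parent // ltnn.
Qed.

(* Both neighbours of a deepest vertex of a cycle would be its parent.        *)
Lemma tree_of_acyclic : acyclic (tree_of f).
Proof.
move=> s s3 sC; have [x0 x0s] : exists x, x \in s.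
  by case: s s3 {sC} => // x s _; exists x; rewrite mem_head.
have [u us umax] := arg_maxnP depth x0s.
have [i s' sE] := rot_to us.
have := s3; rewrite -(size_rot i) sE; move: sC; rewrite -(rot_ucycle i) sE.
have {}umax y : y \in u :: s' -> (depth y <= depth u)%N.
  by rewrite -sE mem_rot; exact: umax.
case: s' sE umax => [|a [|b s']] // sE umax; rewrite /ucycle /=.
move=> /andP[/and3P[ua _ +] /and3P[_ + _]] _.
rewrite rcons_path => /andP[_ bu] a_s.
rewrite adj_sym in bu.
have aE : a = f u.
  by apply: adj_tree_of_depth ua (umax _ _); rewrite !inE eqxx orbT.
have bE : last b s' = f u.
  by apply: adj_tree_of_depth bu (umax _ _); rewrite in_cons in_cons mem_last !orbT.
by rewrite aE -bE mem_last in a_s.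
Qed.

Lemma tree_of_spanning : is_spanning_tree (tree_of f).
Proof. by split; [exact: tree_of_connected|exact: tree_of_acyclic]. Qed.

(** The path follows [f]. The bound on depths shows that a child put in front of the path is not
    already on it. *)
Lemma tree_of_path u : exists s,
  [/\ path (adj (tree_of f)) u s, last u s = v,
      all (fun x => (depth x <= depth u)%N) s & uniq (u :: s)].
Proof.
move: {2}(depth u) (erefl (depth u)) => n; elim: n u => [|n IHn] u du.
  by exists [::]; split => //=; move/eqP: du; rewrite findex_eq0 => /eqP.
have uv : u != v.
  by apply/eqP => uv; move: du; rewrite uv /depth findex0.
have dfu : depth (f u) = n by move: du; rewrite depth_parent // => -[].
have [s [ps sv ds us]] := IHn _ dfu; exists (f u :: s); split => //=.
- by rewrite adj_tree_of.
- rewrite (depth_parent uv) leqnSn /=; apply: sub_all ds => x xu.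
  exact: leqW.
apply/andP; split => //; apply/negP; rewrite inE => /orP[/eqP uE|us'].
  by have := depth_parent uv; rewrite -uE => /eqP; rewrite -addn1
    -[X in X == _]addn0 eqn_add2l.
by move/allP: ds => /(_ _ us'); rewrite (depth_parent uv) ltnn.
Qed.

Lemma parent_tree_of u : parent (tree_of f) u = f u.
Proof.
have [fv _ fE] := fP; have [->|uv] := eqVneq u v; first by rewrite parent_root.
have [e eu] := fE u uv; apply: (parentE tree_of_spanning _ eu).
have [s [ps sv ds us]] := tree_of_path (f u); exists (f u), s; split => //.
  by apply/tree_ofP; exists u.
apply/andP; split => //; apply/negP; rewrite inE => /orP[/eqP uE|us'].
  by move: (ends_neq eu); rewrite -uE eqxx.
by move/allP: ds => /(_ _ us'); rewrite (depth_parent uv) ltnn.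
Qed.

End ParentMap.

(** Each edge of the tree leaves exactly one vertex other than the root, and each inner sum has a
    single term. The right-hand side has the shape that the matrix-tree theorem sums. *)
Lemma prod_tree_edges (K : comNzRingType) (w : edge G -> K) t :
  is_spanning_tree t ->
  \prod_(e in t) w e = \prod_(u | u != v) \sum_(e | `[< outgoing v t u e >]) w e.
Proof.
move=> tT; have fP := is_parent_map_parent tT.
pose src e := odflt v [pick u | (u != v) && (ends e == [set u; parent t u]%SET)].
have srcP e u : u != v -> ends e = [set u; parent t u]%SET -> src e = u.
  move=> uv eu; rewrite /src; case: pickP => /= [z /andP[zv /eqP ez]|].
    by apply: (parent_map_set2 fP zv uv); rewrite -eu.
  by move/(_ u); rewrite uv eu eqxx.
rewrite (partition_big src (fun u => u != v)) => [|e]; last first.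
  rewrite -{1}(tree_of_parent tT) => /tree_ofP[u uv eu].
  by rewrite (srcP e u).
apply: eq_bigr => u uv; have [e oe] := outgoing_exists tT.1 uv.
have eu := (outgoing_parent e tT uv).1 oe.
rewrite (big_pred1 e) => [|e' /=]; last first.
  apply/andP/eqP => [[]|->].
    rewrite -{1}(tree_of_parent tT) => /tree_ofP[z zv ez].
    rewrite (srcP _ z) // => /eqP zu; apply: ends_inj.
    by rewrite eu ez zu.
  by rewrite (srcP _ u) // eqxx; split => //; have [w' [s []]] := oe.
rewrite (big_pred1 e) // => e' /=; apply/asboolP/eqP => [oe'|-> //].
exact: outgoing_inj tT.2 oe' oe.
Qed.

Lemma spanning_treeP (t : spanning_tree G) : is_spanning_tree t.
Proof. by case: t => t /= /asboolP. Qed.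

(** Among the maps counted by [det_laplacian], one with some pair [{u, f u}] that is not an edge
    contributes an empty factor; the others correspond to spanning trees through [parent] and
    [tree_of]. *)
Lemma sum_spanning_trees (K : fieldType) (c : vertex G -> edge G -> K) :
  \sum_(t : spanning_tree G)
    \prod_(u | u != v) \sum_(e | `[< outgoing v t u e >]) c u e =
  \det (finmx (laplacian v (fun u z => \sum_(e | ends e == [set u; z]%SET) c u e))).
Proof.
rewrite det_laplacian; set F := BIG_F.
pose P (f : {ffun vertex G -> vertex G}) : bool := `[< is_parent_map f >].
have PE (g : {ffun vertex G -> vertex G}) :
    P g -> (g v == v) && [forall u, fconnect g u v].
  by move/asboolP => [-> fC _]; rewrite eqxx; apply/forallP.
rewrite [RHS](bigID P) /= [X in _ = _ + X]big1 ?addr0 => [|f]; last first.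
  case/andP=> /andP[/eqP fv /forallP fC] /asboolPn nP.
  have [u /andP[uv /existsPn no]] :
      exists u, (u != v) && ~~ [exists e, ends e == [set u; f u]%SET].
    apply/existsP; apply: contra_notT nP => /existsPn no; split=> // u uv.
    have := no u; rewrite uv negbK => /existsP[e /eqP eu].
    by exists e.
  by rewrite (bigD1 u) //= big_pred0 ?mul0r // => e; apply: negbTE.
rewrite (reindex_omap (fun t : spanning_tree G => [ffun u => parent t u])
  (fun f : {ffun vertex G -> vertex G} => insub (tree_of f))) /=; last first.
  move=> f /andP[_ /asboolP fP]; case: insubP => /= [t _ tE|/asboolP[]].
    congr Some; apply/ffunP => u; rewrite ffunE tE.
    exact: parent_tree_of.
  exact: tree_of_spanning.
have ffunP' (t : spanning_tree G) :
    ([ffun u => parent t u] : _ -> _) = parent t.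
  by apply/funext => u; rewrite ffunE.
apply: eq_big => [t|t _].
  have tT := spanning_treeP t.
  have Pt : P [ffun u => parent t u].
    by apply/asboolP; rewrite ffunP'; exact: is_parent_map_parent.
  rewrite (PE _ Pt) Pt ffunP' (tree_of_parent tT).
  by rewrite (insubT _ (valP t)) /=; apply/esym/eqP; congr Some; apply: val_inj.
apply: eq_bigr => u uv; apply: eq_bigl => e.
rewrite ffunE; apply/asboolP/eqP => /(outgoing_parent _ (spanning_treeP t) uv) //.
Qed.

End Trees.

(** * Edges and their mirror images *)

(* An injective path in a Hausdorff space is a homeomorphism onto its image,  *)
(* so [rho] induces a continuous involution of [0, 1] fixing the end points.  *)
(* It is increasing, hence the identity.                                      *)
Lemma arc_involution_id (R : realType) (S : topologicalType) (g : R -> S)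
    (rho : S -> S) :
  hausdorff_space S -> continuous rho -> involutive rho ->
  {within `[0, 1], continuous g} -> {in `[0, 1] &, injective g} ->
  rho (g 0) = g 0 -> rho (g 1) = g 1 ->
  (forall t, t \in `[0, 1] -> exists2 s, s \in `[0, 1] & g s = rho (g t)) ->
  {in `[0, 1], forall t, rho (g t) = g t}.
Proof.
move=> hS rho_cont rhoK g_cont g_inj rho0 rho1 g_rho.
have /choice[h hP] (t : R) : exists s, t \in `[0, 1] ->
    s \in `[0, 1] /\ g s = rho (g t).
  have [/g_rho[s sI gs]|tI] := boolP (t \in `[0, 1]); first by exists s.
  by exists 0.
have I0 : (0 : R) \in `[0, 1] by rewrite in_itv /= lexx ler01.
have I1 : (1 : R) \in `[0, 1] by rewrite in_itv /= lexx ler01.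
have hI t : t \in `[0, 1] -> h t \in `[0, 1] by move=> /hP[].
have gh t : t \in `[0, 1] -> g (h t) = rho (g t) by move=> /hP[].
have hK : {in `[0, 1], involutive h}.
  move=> t tI; apply: g_inj => //; first exact/hI/hI.
  by rewrite !gh ?hI // rhoK.
have h0 : h 0 = 0 by apply: g_inj; rewrite ?hI // gh.
have h1 : h 1 = 1 by apply: g_inj; rewrite ?hI // gh.
have h_inj : {in `[0, 1] &, injective h}.
  by move=> s t sI tI hst; rewrite -(hK s sI) hst hK.
have h_cont : {within `[0, 1], continuous h}.
  apply/continuous_closedP => A clA.
  have K_closed : closed (g @` (`[0, 1] `&` A)).
    apply: compact_closed => //; apply: continuous_compact.
      by apply: continuous_subspaceW g_cont => t [].
    by apply: compact_closedI => //; exact: segment_compact.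
  have : closed ((rho \o g : subspace `[0, 1] -> S) @^-1` (g @` (`[0, 1] `&` A))).
    move: K_closed; apply: (continuous_closedP _).1 => t.
    exact: (cvg_comp _ _ (g_cont t) (rho_cont (g t))).
  move/closed_subspaceP => [V clV VE]; apply/closed_subspaceP; exists V => //.
  rewrite VE; apply/seteqP; split => t [] /= tA tI; split => //.
    case: tA => s [sI sA] gs; suff hts : h t = s by rewrite -hts in sA.
    by apply: g_inj => //; rewrite ?hI // gh.
  by exists (h t); [split => //; exact: hI|rewrite gh].
have h_mono : {in `[0, 1] &, {mono h : x y / x <= y}}.
  by apply: segment_continuous_inj_le; rewrite ?h0 ?h1.
(* An increasing involution is the identity: applying [h] to [t <= h t] gives the reverse
   inequality. *)
move=> t tI; rewrite -gh //; congr g; apply: le_anti.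
have /orP[le_t|le_t] := le_total t (h t); move: le_t.
  by rewrite -h_mono ?hI // hK // => ->.
by rewrite -h_mono ?hI // hK // => ->.
Qed.

Section Reflection.
Context {R : realType} {G : plane_graph R} (c : R).
Implicit Types (x y z u : vertex G) (e f : edge G) (p q : R * R).

Lemma reflect_lineK : involutive (reflect_line c).
Proof. by case=> a b; rewrite /reflect_line /= subKr. Qed.

Lemma reflect_line_continuous : continuous (reflect_line c).
Proof.
case=> a b; apply: (@cvg_pair _ _ _ _ (nbhs a) (nbhs (c *+ 2 - b))).
  exact: cvg_fst.
by apply: cvgB; [exact: cvg_cst|exact: cvg_snd].
Qed.

Lemma reflect_line_id p : line c p <-> reflect_line c p = p.
Proof.
case: p => a b; rewrite /line /reflect_line /=; split => [->|[]].
  by rewrite mulr2n addrK.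
by move=> E; lra.
Qed.

Lemma curve_location e x : x \in ends e -> curve e (location x).
Proof.
have [a [b [_ -> [g [_ _ g0 g1 ->]]]]] := edge_arc e.
rewrite !inE => /orP[]/eqP->; [exists 0|exists 1] => //.
  by rewrite /= in_itv /= lexx ler01.
by rewrite /= in_itv /= lexx ler01.
Qed.

Definition mirror_edge e f : Prop := curve f = reflect_line c @` curve e.

Lemma mirror_edge_sym e f : mirror_edge e f -> mirror_edge f e.
Proof.
move=> ef; rewrite /mirror_edge ef image_comp.
apply/seteqP; split=> [p pe|_ [p pe <-]] /=.
  by exists p => //; exact: reflect_lineK.
by rewrite reflect_lineK.
Qed.

Lemma mirror_curve e f p : mirror_edge e f -> curve e p -> curve f (reflect_line c p).
Proof. by move=> -> ep; exists p. Qed.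

Definition inner e p : Prop :=
  curve e p /\ (forall x, x \in ends e -> p <> location x).

Lemma inner_location e p x : inner e p -> p <> location x.
Proof. by case=> ep pe px; apply: (pe x) => //; apply: curve_vertex; rewrite -px. Qed.

Variable sigma : vertex G -> vertex G.
Hypothesis sigmaE : forall x, location (sigma x) = reflect_line c (location x).

Lemma sigmaK : involutive sigma.
Proof. by move=> x; apply: (@location_inj _ G); rewrite !sigmaE reflect_lineK. Qed.

Lemma sigma_fixed x : line c (location x) <-> sigma x = x.
Proof.
rewrite reflect_line_id -sigmaE.
by split=> [|-> //]; exact: (@location_inj _ G).
Qed.

Lemma mirror_ends e f x : mirror_edge e f -> (x \in ends f) = (sigma x \in ends e).
Proof.
move=> ef; apply/idP/idP => [/curve_location|/curve_location] xe.
  apply: curve_vertex; rewrite sigmaE; apply: mirror_curve xe.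
  exact: mirror_edge_sym.
by apply: curve_vertex; rewrite -(sigmaK x) sigmaE; exact: mirror_curve xe.
Qed.

Lemma mirror_inner e f p : mirror_edge e f -> inner e p -> inner f (reflect_line c p).
Proof.
move=> ef [ep pe]; split=> [|x]; first exact: mirror_curve ep.
rewrite (mirror_ends _ ef) => /pe + E; apply.
by rewrite sigmaE -E reflect_lineK.
Qed.

(** The reflection preserves the two ends of [e] and fixes [u], hence fixes both; by
    [arc_involution_id] it then fixes every point of the arc. *)
Lemma self_mirror_on_line e u : mirror_edge e e -> u \in ends e ->
  line c (location u) -> curve e `<=` line c.
Proof.
move=> ee ue /sigma_fixed su; have [a [b [ab eab [g [gc gi g0 g1 eE]]]]] := edge_arc e.
have s_id x : x \in ends e -> sigma x = x.
  move=> xe; have [->//|xu] := eqVneq x u.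
  have : sigma x != u by rewrite -su (inj_eq (can_inj sigmaK)).
  have : sigma x \in ends e by rewrite -(mirror_ends x ee).
  move: ue xe xu; rewrite eab !inE => /orP[]/eqP-> /orP[]/eqP->;
  by rewrite ?eqxx // => _ /orP[]/eqP-> //; rewrite ?eqxx.
have loc_id x : x \in ends e -> reflect_line c (location x) = location x.
  by move=> /s_id; rewrite -sigmaE => ->.
rewrite eE => _ [t tI <-]; apply/reflect_line_id.
apply: (arc_involution_id _ reflect_line_continuous reflect_lineK gc gi) tI.
- exact: norm_hausdorff.
- by rewrite g0 loc_id // eab !inE eqxx.
- by rewrite g1 loc_id // eab !inE eqxx orbT.
move=> s sI; have : curve e (reflect_line c (g s)).
  by apply: mirror_curve ee _; rewrite eE; exists s.
by rewrite eE => -[r]; exists r.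
Qed.

(* A point where the interior of [e] meets the line lies on the mirror image  *)
(* of [e] too, which must then be [e] itself.                                 *)
Lemma meets_line_on_line e f u p : mirror_edge e f -> u \in ends e ->
  line c (location u) -> inner e p -> line c p -> curve e `<=` line c.
Proof.
move=> ef ue uc pe /reflect_line_id pc.
have fe : f = e.
  apply: contrapT => /eqP; rewrite eq_sym => fe.
  have fp : curve f p by rewrite -pc; apply: mirror_curve ef _; case: pe.
  have [x _ px] := curve_disjoint fe pe.1 fp.
  exact: inner_location pe px.
by rewrite fe in ef; exact: self_mirror_on_line ef ue uc.
Qed.

Lemma inner_param e : exists g : R -> R * R,
  [/\ {within `[0, 1], continuous g},
      forall t : R, t \in `]0, 1[ -> inner e (g t)
    & forall p, inner e p -> exists2 t : R, t \in `]0, 1[ & g t = p].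
Proof.
have [a [b [ab eab [g [gc gi g0 g1 eE]]]]] := edge_arc e.
have I0 : (0 : R) \in `[0, 1] by rewrite in_itv /= lexx ler01.
have I1 : (1 : R) \in `[0, 1] by rewrite in_itv /= lexx ler01.
exists g; split => // [t tI|p].
  have tI' : t \in `[0, 1] by apply: subset_itv_oo_cc.
  split=> [|x]; first by rewrite eE; exists t.
  move: tI; rewrite eab in_itv !inE /= => /andP[t0 t1] /orP[]/eqP->.
    by rewrite -g0 => /gi; move=> /(_ tI' I0) E; rewrite E ltxx in t0.
  by rewrite -g1 => /gi; move=> /(_ tI' I1) E; rewrite E ltxx in t1.
rewrite /inner eE eab => -[[t tI <-] pe]; exists t => //.
move: tI; rewrite /= !in_itv /= => /andP[t0 t1].
rewrite !lt_neqAle t0 t1 !andbT; apply/andP; split.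
  by apply/negP => /eqP E; apply: (pe a); rewrite ?inE ?eqxx // -E g0.
by apply/negP => /eqP E; apply: (pe b); rewrite ?inE ?eqxx ?orbT // E g1.
Qed.

(** Intermediate values of the height between two interior parameters, so that the crossing point is
    not an end. *)
Lemma inner_crosses_line e p q : inner e p -> inner e q ->
  p.2 <= c -> c <= q.2 -> exists2 r, inner e r & line c r.
Proof.
have [g [gc gI gP]] := inner_param e.
move=> /gP[s sI <-] /gP[t tI <-] gsc gtc.
have gc2 : {within `[0, 1], continuous (snd \o g)}.
  by move=> x; apply: (cvg_comp _ _ (gc x)); exact: cvg_snd.
have cross a b : a \in `]0, 1[ -> b \in `]0, 1[ -> a <= b ->
    Num.min (g a).2 (g b).2 <= c <= Num.max (g a).2 (g b).2 ->
    exists2 r, inner e r & line c r.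
  rewrite !in_itv /= => /andP[a0 a1] /andP[b0 b1] ab cab.
  have ab_cont : {within `[a, b], continuous (snd \o g)}.
    apply: continuous_subspaceW gc2 => z; rewrite /= !in_itv /= => /andP[az zb].
    by rewrite (le_trans (ltW a0) az) (le_trans zb (ltW b1)).
  have [z zab zc] := IVT ab ab_cont cab.
  exists (g z) => //; apply: gI; move: zab; rewrite !in_itv /= => /andP[az zb].
  by rewrite (lt_le_trans a0 az) (le_lt_trans zb b1).
have [st|ts] := leP s t.
  by apply: (cross s t) => //; rewrite ge_min le_max gsc gtc orbT.
apply: (cross t s) => //; first exact: ltW.
by rewrite ge_min le_max gsc gtc orbT.
Qed.

(** An inner point and its mirror image cannot both be above the line. If neither edge is above, [e]
    has inner points at heights at most [c] and at least [c]; its interior then meets the line,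
    which would force [e] into it. *)
Lemma edge_above_mirror e f u : mirror_edge e f -> u \in ends e ->
  line c (location u) -> ~ (curve e `<=` line c) ->
  edge_above c f <-> ~ edge_above c e.
Proof.
move=> ef ue uc eNc; have fe := mirror_edge_sym ef; split=> [fA eA|eNA q fq qf].
  have [g [_ /(_ 2^-1) gI _]] := inner_param e.
  have /gI pe : 2^-1 \in (`]0, 1[ : interval R) by rewrite in_itv /=; apply/andP; split; lra.
  have := eA _ pe.1 pe.2; have [qf qfe] := mirror_inner ef pe.
  by have := fA _ qf qfe; rewrite /reflect_line /= => *; lra.
apply: contrapT => /negP; rewrite -leNgt => qc; apply: eNA => p ep pe.
rewrite ltNge; apply/negP => pc; apply: eNc.
have eq : inner e (reflect_line c q) by apply: mirror_inner fe _.
have [||r re rc] := @inner_crosses_line e p (reflect_line c q) _ eq pc.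
- by split.
- by rewrite /reflect_line /=; lra.
exact: meets_line_on_line ef ue uc re rc.
Qed.

End Reflection.

(** * Trees with a prescribed pattern *)

Lemma sum_outgoing (R : realType) (G : plane_graph R) (v u : vertex G)
    (t : {set edge G}) (e : edge G) (K : nmodType) (F : edge G -> K) :
  is_spanning_tree t -> outgoing v t u e ->
  \sum_(e' | `[< outgoing v t u e' >]) F e' = F e.
Proof.
move=> tT oe; rewrite (big_pred1 e) // => e' /=.
by apply/asboolP/eqP => [oe'|-> //]; exact: outgoing_inj tT.2 oe' oe.
Qed.

Definition above_pattern (R : realType) (G : plane_graph R) (c : R)
    (v : vertex G) (n : nat) (vs : 'I_n -> vertex G) (t : spanning_tree G) :
  {ffun 'I_n -> bool} :=
  [ffun i => `[< exists2 e, outgoing v t (vs i) e & edge_above c e >]].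

Section Pattern.
Context {R : realType} {G : plane_graph R} (w : edge G -> R) (c : R).
Variables (v : vertex G) (n : nat) (vs : 'I_n -> vertex G).
Hypothesis vs_inj : injective vs.
Hypothesis vsP : forall i, isolated_on_line c v (vs i).

(** The vertex [u] is the tail of [e]; the condition is vacuous unless [u] is some [vs i]. *)
Definition pattern_weight (y : {ffun 'I_n -> bool}) (u : vertex G) (e : edge G) : R :=
  if [forall i, (vs i == u) ==> (`[< edge_above c e >] == y i)] then w e else 0.

Lemma prod_pattern_weight y (t : spanning_tree G) :
  \prod_(u | u != v) \sum_(e | `[< outgoing v t u e >]) pattern_weight y u e =
  if above_pattern c v vs t == y then tree_weight w t else 0.
Proof.
have tT := spanning_treeP t.
have aboveE i e : outgoing v t (vs i) e ->
    above_pattern c v vs t i = `[< edge_above c e >].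
  move=> oe; rewrite ffunE; apply/asboolP/asboolP => [[e' oe']|eA].
    by rewrite (outgoing_inj tT.2 oe' oe).
  by exists e.
case: eqP => [<-|/eqP ty].
  rewrite /tree_weight (prod_tree_edges v w tT); apply: eq_bigr => u uv.
  have [e oe] := outgoing_exists tT.1 uv.
  rewrite !(sum_outgoing _ tT oe) /pattern_weight ifT //.
  apply/forallP => i; apply/implyP => /eqP iu; rewrite (aboveE i e) //.
  by rewrite iu.
have [i ti] : exists i, above_pattern c v vs t i != y i.
  apply/existsP; apply: contraNT ty => /existsPn E; apply/eqP/ffunP => i.
  exact/eqP/negbNE/E.
have [iv _ _] := vsP i; rewrite (bigD1 (vs i)) //=.
have [e oe] := outgoing_exists tT.1 iv.
rewrite (sum_outgoing _ tT oe) /pattern_weight ifF ?mul0r //.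
apply/negbTE/forallPn; exists i; rewrite eqxx /=.
by rewrite -(aboveE i e).
Qed.

Variables (sigma : vertex G -> vertex G) (tau : edge G -> edge G).
Hypothesis sigmaE : forall x, location (sigma x) = reflect_line c (location x).
Hypothesis tauP : forall e, mirror_edge c e (tau e).
Hypothesis w_tau : forall e, w (tau e) = w e.
Hypothesis v_line : line c (location v).

Lemma tau_ends e x y : ends e = [set x; y]%SET ->
  ends (tau e) = [set sigma x; sigma y]%SET.
Proof.
move=> exy; apply/setP => z; rewrite (mirror_ends sigmaE z (tauP e)) exy !inE.
by rewrite !(can2_eq (sigmaK sigmaE) (sigmaK sigmaE)).
Qed.

Lemma tauK : involutive tau.
Proof.
move=> e; apply: ends_inj; have [x [y [_ exy _]]] := edge_arc e.
by rewrite (tau_ends (tau_ends exy)) !(sigmaK sigmaE) exy.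
Qed.

Lemma tau_endsE e x y :
  (ends (tau e) == [set x; y]%SET) = (ends e == [set sigma x; sigma y]%SET).
Proof.
apply/eqP/eqP => [/tau_ends|/tau_ends]; first by rewrite tauK.
by rewrite !(sigmaK sigmaE).
Qed.

Definition edge_sum (b : vertex G -> edge G -> R) u z : R :=
  \sum_(e | ends e == [set u; z]%SET) b u e.

Lemma edge_sum_sigma (b : vertex G -> edge G -> R) u z :
  edge_sum b (sigma u) (sigma z) = \sum_(e | ends e == [set u; z]%SET) b (sigma u) (tau e).
Proof.
rewrite /edge_sum (reindex_inj (can_inj tauK)) /=.
by apply: eq_bigl => e; rewrite tau_endsE !(sigmaK sigmaE).
Qed.

Lemma sigma_vs i : sigma (vs i) = vs i.
Proof. by apply/(sigma_fixed sigmaE); case: (vsP i). Qed.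

Lemma sigma_v : sigma v = v.
Proof. exact/(sigma_fixed sigmaE). Qed.

(** Of an edge at [vs i] and its mirror image, exactly one lies on the side prescribed by [y i], and
    both have the same weight. *)
Lemma edge_sum_half y i z :
  edge_sum (pattern_weight y) (vs i) z + edge_sum (pattern_weight y) (vs i) (sigma z) =
  edge_sum (fun=> w) (vs i) z.
Proof.
rewrite -{2}(sigma_vs i) edge_sum_sigma sigma_vs /edge_sum -big_split /=.
apply: eq_bigr => e /eqP ei; have [_ il iN] := vsP i.
have ie : vs i \in ends e by rewrite ei !inE eqxx.
have okE e' : [forall j, (vs j == vs i) ==> (`[< edge_above c e' >] == y j)] =
    (`[< edge_above c e' >] == y i).
  apply/forallP/idP => [/(_ i)|E j]; first by rewrite eqxx.
  by apply/implyP => /eqP/vs_inj ->.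
rewrite /pattern_weight !okE w_tau.
have -> : `[< edge_above c (tau e) >] = ~~ `[< edge_above c e >].
  rewrite -asbool_neg; apply/asbool_equiv_eq.
  exact: edge_above_mirror sigmaE _ _ _ (tauP e) ie il (iN _ ie).
by case: `[< _ >] (y i) => -[]; rewrite ?addr0 ?add0r.
Qed.

Lemma laplacian_sigma (a : vertex G -> vertex G -> R) u x :
  (forall z, a (sigma u) (sigma z) = a u z) ->
  laplacian v a (sigma u) (sigma x) = laplacian v a u x.
Proof.
move=> a_sigma; have sI := can_inj (sigmaK sigmaE).
have sv z : (sigma z == v) = (z == v) by rewrite -{1}sigma_v (inj_eq sI).
rewrite /laplacian !sv; case: (u == v) => //.
rewrite (reindex_inj sI) /=; apply: eq_bigr => z _.
by rewrite a_sigma !(inj_eq sI).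
Qed.

Lemma laplacian_half (y : {ffun 'I_n -> bool}) i x :
  laplacian v (edge_sum (pattern_weight y)) (vs i) x +
  laplacian v (edge_sum (pattern_weight y)) (vs i) (sigma x) =
  laplacian v (edge_sum (fun=> w)) (vs i) x.
Proof.
have sI := can_inj (sigmaK sigmaE).
have xE : (sigma x == vs i) = (x == vs i) by rewrite -{1}(sigma_vs i) (inj_eq sI).
have [iv _ _] := vsP i; rewrite /laplacian (negPf iv).
rewrite [X in _ + X](reindex_inj sI) /= -big_split /=; apply: eq_bigr => z _.
by rewrite xE (inj_eq sI) -mulrDl edge_sum_half.
Qed.

Hypothesis w_gt0 : forall e, 0 < w e.

(** The tree [t0] makes the total weight positive, so that the Laplacian is invertible, as
    [det_half_rows] requires. *)
Lemma sum_pattern_weight (t0 : spanning_tree G) (y : {ffun 'I_n -> bool}) :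
  \sum_(t : spanning_tree G | above_pattern c v vs t == y) tree_weight w t =
  2^-1 ^+ n * \sum_(t : spanning_tree G) tree_weight w t.
Proof.
have sumE : \sum_(t : spanning_tree G) tree_weight w t =
    \det (finmx (laplacian v (edge_sum (fun=> w)))).
  rewrite -sum_spanning_trees; apply: eq_bigr => t _.
  exact: prod_tree_edges (spanning_treeP t).
have sum_gt0 : 0 < \sum_(t : spanning_tree G) tree_weight w t.
  rewrite (bigD1 t0) //= ltr_wpDr //; last by apply: prodr_gt0.
  by apply: sumr_ge0 => t _; apply: prodr_ge0 => e _; exact: ltW.
rewrite big_mkcond /=; under eq_bigr do rewrite -prod_pattern_weight.
rewrite sum_spanning_trees sumE.
pose s (i : 'I_#|vertex G|) := enum_rank (sigma (enum_val i)).
have S_inj : injective (fun i => enum_rank (vs i)).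
  by move=> i j /enum_rank_inj/vs_inj.
rewrite (@det_half_rows _ _ (finmx (laplacian v (edge_sum (fun=> w)))) _ s
  [set enum_rank (vs i) | i : 'I_n]%SET).
- by rewrite card_imset // card_ord.
- by rewrite pnatr_eq0.
- by rewrite unitmxE -sumE unitfE gt_eqF.
- by move=> i; rewrite /s enum_rankK (sigmaK sigmaE) enum_valK.
- move=> i j; rewrite !mxE !enum_rankK laplacian_sigma // => z.
  by rewrite edge_sum_sigma; apply: eq_bigr => e _; rewrite w_tau.
- by move=> _ /imsetP[i _ ->]; rewrite /s enum_rankK sigma_vs.
- move=> i iS; apply/rowP => j; rewrite !mxE /laplacian; case: ifP => // _.
  apply: eq_bigr => z _; congr (_ * _); apply: eq_bigr => e _.
  rewrite /pattern_weight ifT //; apply/forallP => k; apply/implyP => /eqP ki.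
  by case/imsetP: iS; exists k => //; rewrite ki enum_valK.
move=> _ j /imsetP[i _ ->]; rewrite !mxE !enum_rankK.
exact: laplacian_half.
Qed.

End Pattern.

Lemma sum_symmetric_pattern (R : realType) (G : plane_graph R) (w : edge G -> R)
    (c : R) (v : vertex G) (n : nat) (vs : 'I_n -> vertex G)
    (t0 : spanning_tree G) (y : {ffun 'I_n -> bool}) :
  (forall e, 0 < w e) -> symmetric_graph w c -> line c (location v) ->
  injective vs -> (forall i, isolated_on_line c v (vs i)) ->
  \sum_(t : spanning_tree G | above_pattern c v vs t == y) tree_weight w t =
  2^-1 ^+ n * \sum_(t : spanning_tree G) tree_weight w t.
Proof.
move=> w_gt0 [/choice[sigma sigmaE] mirror] v_line vs_inj vsP.
have /choice[tau tauE] (e : edge G) : exists f, mirror_edge c e f /\ w f = w e.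
  by have [f ef wf] := mirror e; exists f.
have tauP e : mirror_edge c e (tau e) by case: (tauE e).
have w_tau e : w (tau e) = w e by case: (tauE e).
exact: sum_pattern_weight sigmaE tauP w_tau v_line w_gt0 t0 y.
Qed.

(** * Laws on finite types *)

Section FiniteLaw.
Context d (Omega : measurableType d) (R : realType) (P : probability Omega R).

Lemma has_law_preimage (T : finType) (X : Omega -> T) (mu : T -> R) (B : pred T) :
  has_law P X mu ->
  measurable (X @^-1` [set t | B t]) /\
  P (X @^-1` [set t | B t]) = (\sum_(t | B t) mu t)%:E.
Proof.
move=> XP; have -> : X @^-1` [set t | B t] =
    \bigcup_(t in [set t | B t]) (X @^-1` [set t]).
  by apply/seteqP; split=> [omega Bo|omega [t Bt /= ->] //]; exists (X omega).
have mX t : [set t | B t] t -> measurable (X @^-1` [set t]).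
  by move=> _; case: (XP t).
split; first exact: fin_bigcup_measurable finite_finset mX.
rewrite measure_fin_bigcup //; last 2 first.
- exact: finite_finset.
- by move=> s t _ _ [omega [/= <- <-]].
rewrite (fsbigE [seq t <- index_enum T | B t]); last 3 first.
- by rewrite filter_uniq // index_enum_uniq.
- by move=> t /=; rewrite mem_filter => /andP[].
- by move=> t Bt; rewrite mem_filter Bt mem_index_enum.
rewrite big_filter_cond -sumEFin; apply: eq_big => [t|t _]; last by case: (XP t).
by rewrite andb_idr // => Bt; rewrite inE.
Qed.

Lemma has_law_comp (T U : finType) (X : Omega -> T) (mu : T -> R) (h : T -> U) :
  has_law P X mu ->
  has_law P (h \o X) (fun y => \sum_(t | h t == y) mu t).
Proof.
move=> XP y; have -> : (h \o X) @^-1` [set y] = X @^-1` [set t | h t == y].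
  by apply/seteqP; split => omega /= /eqP.
exact: has_law_preimage.
Qed.

(** The constant [2^-1 ^+ n] is a product of one factor per coordinate, so its sum over a product
    set of patterns is a product of sums. *)
Lemma uniform_bits (n : nat) (X : Omega -> {ffun 'I_n -> bool}) :
  has_law P X (fun=> 2^-1 ^+ n) ->
  [/\ forall i, measurable_fun [set: Omega] (fun omega => X omega i),
      mutually_independent P (fun i omega => X omega i)
    & forall i, pushforward P (fun omega => X omega i) =1 bernoulli_prob 2^-1].
Proof.
move=> XP.
have marginals (J : {set 'I_n}) (A : 'I_n -> set bool) :
    P (\bigcap_(i in [set i | i \in J]) ((fun omega => X omega i) @^-1` A i)) =
    (\prod_(i in J) \sum_(b | b \in A i) 2^-1)%:E.
  pose B (y : {ffun 'I_n -> bool}) := [forall i, (i \in J) ==> (y i \in A i)].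
  have -> : \bigcap_(i in [set i | i \in J]) ((fun omega => X omega i) @^-1` A i) =
      X @^-1` [set y | B y].
    apply/seteqP; split => omega /=.
      by move=> XA; apply/forallP => i; apply/implyP => /XA; rewrite inE.
    by move/forallP => XA i /=; move/implyP: (XA i) => /[apply]; rewrite inE.
  rewrite (has_law_preimage B XP).2; congr (_%:E).
  (* A coordinate outside [J] ranges over both bits and contributes [2^-1 + 2^-1 = 1]. *)
  transitivity (\prod_(i < n) \sum_(b | (i \in J) ==> (b \in A i)) (2^-1 : R)).
    rewrite bigA_distr_big_dep; apply: eq_big => [y|y _].
      by apply/forallP/familyP.
    by rewrite prodr_const card_ord.
  rewrite [RHS]big_mkcond; apply: eq_bigr => i _; case: (i \in J) => //=.
  by rewrite big_bool /=; lra.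
have marginal i (A : set bool) :
    P ((fun omega => X omega i) @^-1` A) = (\sum_(b | b \in A) 2^-1)%:E.
  have := marginals [set i]%SET (fun=> A); rewrite big_set1 => <-.
  congr (P _); apply/seteqP; split => [omega Ao j /=|omega]; first by rewrite inE => /eqP->.
  by apply; rewrite /= inE.
split=> [i _ A _|J A _|i A].
- rewrite setTI; have -> : (fun omega => X omega i) @^-1` A = X @^-1` [set y | y i \in A].
    by apply/seteqP; split => omega /=; rewrite inE.
  by have [] := has_law_preimage (fun y : {ffun 'I_n -> bool} => y i \in A) XP.
- by rewrite marginals -prodEFin; apply: eq_bigr => i _; rewrite marginal.
rewrite /pushforward marginal bernoulli_probE; last by lra.
rewrite big_mkcond big_bool /= EFinD !diracE; congr (_ + _)%E.
  by case: (true \in A); rewrite ?mule1 ?mule0.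
have -> : unstable.onem (2^-1 : R) = 2^-1 by rewrite /unstable.onem; lra.
by case: (false \in A); rewrite ?mule1 ?mule0.
Qed.

End FiniteLaw.

(** * From weights of trees to the joint law of the sides *)

Theorem theorem6p4 (R : realType) (G : plane_graph R) (w : edge G -> R) (c : R)
    (v : vertex G) (n : nat) (vs : 'I_n -> vertex G)
    (d : measure_display) (Omega : measurableType d) (P : probability Omega R)
    (T : Omega -> spanning_tree G)
    (w_gt0 : forall e, 0 < w e)
    (G_connected : spans_connected [set: edge G]%SET)
    (G_symmetric : symmetric_graph w c)
    (v_line : line c (location v))
    (v_face : on_unbounded_face v)
    (vs_inj : injective vs)
    (vsP : forall u, (exists i, vs i = u) <-> isolated_on_line c v u)
    (T_law : has_law P T (@uniform_tree_law R G) \/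
             has_law P T (weighted_tree_law w)) :
  let Y (i : 'I_n) (omega : Omega) : bool :=
    `[< exists2 e, outgoing v (T omega) (vs i) e & edge_above c e >] in
  [/\ forall i, measurable_fun [set: Omega] (Y i),
      mutually_independent P Y
    & forall i, pushforward P (Y i) =1 bernoulli_prob 2^-1].
Proof.
(* The uniform law is the weighted law of constant weights [1], so both cases reduce to one. *)
have [w' [w'_gt0 w'_sym T_law']] : exists w' : edge G -> R,
    [/\ forall e, 0 < w' e, symmetric_graph w' c & has_law P T (weighted_tree_law w')].
  case: T_law => TP; last by exists w.
  exists (fun=> 1); split => //.
    split; first exact: G_symmetric.1.
    by move=> e; have [f ef _] := G_symmetric.2 e; exists f.
  move=> t; have -> : weighted_tree_law (fun=> 1) t = @uniform_tree_law R G t.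
    have tw1 t' : @tree_weight R G (fun=> 1) t' = 1 by rewrite /tree_weight big1.
    rewrite /weighted_tree_law /uniform_tree_law tw1 mul1r.
    by under eq_bigr do rewrite tw1; rewrite sumr_const.
  exact: TP.
(* A space of probability one is nonempty; [T omega0] then provides a spanning tree. *)
have [omega0 _] : [set: Omega] !=set0.
  by apply/set0P/eqP => E; have := probability_setT P; rewrite E measure0 => -[] /eqP;
     rewrite eq_sym oner_eq0.
have vs_isolated i : isolated_on_line c v (vs i) by apply/vsP; exists i.
pose X := above_pattern c v vs \o T.
have X_law : has_law P X (fun=> 2^-1 ^+ n).
  have := has_law_comp (above_pattern c v vs) T_law'.
  congr has_law; apply/funext => y; rewrite /weighted_tree_law -mulr_suml.
  rewrite (sum_symmetric_pattern (T omega0)) // mulfK // gt_eqF //.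
  rewrite (bigD1 (T omega0)) //= ltr_wpDr //; last by apply: prodr_gt0.
  by apply: sumr_ge0 => t _; apply: prodr_ge0 => e _; exact: ltW.
have -> : (fun i omega =>
    `[< exists2 e, outgoing v (T omega) (vs i) e & edge_above c e >]) =
    (fun i omega => X omega i).
  by apply/funext => i; apply/funext => omega; rewrite ffunE.
exact: uniform_bits.
Qed.
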